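(* Consider the storage phase of Zoom-SVD (defined in the context) with block size $b$, applied to a multiple time series with $c$ time series. When a vector $\mathbf{a}_t\in\mathbb{R}^{1\times c}$ is given at time $t$, the computation cost of the storage phase of Zoom-SVD (the cost of processing $\mathbf{a}_t$) is $O(k^2(b+c))$, where $k$ is the number of singular values.
   Context: **Setting.** A multiple time series is a matrix $\mathbf{A}=[\mathbf{a}_1;\mathbf{a}_2;\dots;\mathbf{a}_t]\in\mathbb{R}^{t\times c}$, where $[\,;\,]$ is vertical concatenation, $t$ is the time length, $c$ is the number of time series, and $\mathbf{a}_j\in\mathbb{R}^{1\times c}$ is the row arriving at time $j$. For a block size $b$, the $i$-th block ($i=0,1,2,\dots$) is $\mathbf{A}^{(i)}=[\mathbf{a}_{bi+1};\dots;\mathbf{a}_{bi+b}]\in\mathbb{R}^{b\times c}$; $\mathbf{A}^{(i)}_t$ denotes the (possibly incomplete) most recent block at time $t$, having at most $b$ rows. **SVD and low-rank approximation.** A (truncated) SVD result of a matrix $\mathbf{M}$ with $n$ rows and $c$ columns is a triple $\mathbf{U}\in\mathbb{R}^{n\times k}$, $\mathbf{\Sigma}\in\mathbb{R}^{k\times k}$, $\mathbf{V}\in\mathbb{R}^{c\times k}$ with $\mathbf{M}\simeq\mathbf{U}\mathbf{\Sigma}\mathbf{V}^{T}$, where $\mathbf U,\mathbf V$ are column orthogonal and $\mathbf\Sigma$ is diagonal with the $k$ largest singular values in descending order. If $\sigma_1\ge\dots\ge\sigma_r$ are the singular values of $\mathbf{M}$ ($r$ its rank), the number of retained singular values is the smallest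 $k\in\{1,\dots,r\}$ with $\sum_{i=1}^k\sigma_i^2/\sum_{i=1}^r\sigma_i^2\ge\xi$, for a fixed threshold $\xi\in(0,1)$. **Storage phase.** Start with block index $i=0$ and the SVD result of $\mathbf{a}_1$. When a new row $\mathbf{a}_t$ arrives: 1. If there is no current incomplete block (the previous block has just been completed and stored), set $\mathbf{U}_{(i,t)},\mathbf{\Sigma}_{(i,t)},\mathbf{V}_{(i,t)}$ to be the SVD result of $\mathbf{a}_t$. 2. Otherwise, let $\mathbf{U}_{(i,t-1)},\mathbf{\Sigma}_{(i,t-1)},\mathbf{V}_{(i,t-1)}$ be the SVD result of the current block $\mathbf{A}^{(i)}_{t-1}$. Compute the SVD $\tilde{\mathbf U}\tilde{\mathbf\Sigma}\tilde{\mathbf V}^{T}$ of $\begin{bmatrix}\mathbf{\Sigma}_{(i,t-1)}\mathbf{V}_{(i,t-1)}^{T}\\ \mathbf{a}_t\end{bmatrix}$, and set $\mathbf{U}_{(i,t)}=\begin{bmatrix}\mathbf{U}_{(i,t-1)}&\mathbf{0}\\ \mathbf{0}&1\end{bmatrix}\tilde{\mathbf U}$, $\mathbf{\Sigma}_{(i,t)}=\tilde{\mathbf\Sigma}$, $\mathbf{V}_{(i,t)}^{T}=\tilde{\mathbf V}^{T}$ (with low-rank approximation). 3. If $\mathbf{U}_{(i,t)}$ has $b$ rows, store the triple as the SVD result $(\mathbf{U}_{(i)},\mathbf{\Sigma}_{(i)},\mathbf{V}_{(i)})$ of block $\mathbf{A}^{(i)}$ and replace $i$ by $i+1$. The raw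 data are discarded. **Conventions.** Here $k$ is the number of singular values retained, a single symbol $k$ being used for all SVD results. Cost is the number of arithmetic operations: computing the SVD of an $n\times c$ dense matrix costs $O(\min(n^2c,nc^2))$, and multiplying a $p\times q$ matrix by a $q\times s$ matrix costs $O(pqs)$. *)

(* Defs.v *)
From mathcomp Require Import all_boot all_order all_algebra.
From mathcomp Require Import reals.

Set Implicit Arguments.
Unset Strict Implicit.
Unset Printing Implicit Defensive.

Import Order.TTheory GRing.Theory Num.Theory.
Local Open Scope ring_scope.

(* (U, Sigma, V), with M approximated by U *m Sigma *m V^T; [svd_rank] is the
   number k of retained singular values. *)
Record svd_result (R : realType) (n c : nat) := SvdResult {
  svd_rank : nat;
  svd_U : 'M[R]_(n, svd_rank);
  svd_S : 'M[R]_svd_rank;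
  svd_V : 'M[R]_(c, svd_rank) }.

(* The rank of M is at most minn n c, so s lists the nonzero singular values
   sigma_1 >= ... >= sigma_r (with s 0 i = sigma_(i+1)) followed by zeros. *)
Definition is_svd (R : realType) (n c : nat) (M : 'M[R]_(n, c))
    (P : 'M[R]_(n, minn n c)) (s : 'rV[R]_(minn n c))
    (Q : 'M[R]_(c, minn n c)) : Prop :=
  [/\ P^T *m P = 1%:M, Q^T *m Q = 1%:M,
      forall i, 0 <= s 0 i,
      forall i j : 'I_(minn n c), (i <= j)%N -> s 0 j <= s 0 i
    & M = P *m diag_mx s *m Q^T].

Definition energy (R : realType) (p : nat) (s : 'rV[R]_p) (k : nat) : R :=
  \sum_(i < p | (i < k)%N) s 0 i ^+ 2.

(* k is the least element of {1, ..., r} that retains a fraction xi of the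
   energy. A zero matrix (r = 0) has no such element; its SVD result keeps one
   singular value, equal to 0, so that data containing zero rows are allowed. *)
Definition is_retained_number (R : realType) (xi : R) (p : nat) (s : 'rV[R]_p)
    (r k : nat) : Prop :=
  if r == 0%N then k = 1%N else
  [/\ (1 <= k <= r)%N, xi <= energy s k / energy s r
    & forall j, (1 <= j <= r)%N -> xi <= energy s j / energy s r -> (k <= j)%N].

Definition is_svd_result (R : realType) (xi : R) (n c : nat) (M : 'M[R]_(n, c))
    (X : svd_result R n c) : Prop :=
  exists P s Q, is_svd M P s Q /\
  is_retained_number xi s (\rank M) (svd_rank X) /\
  exists le_k : (svd_rank X <= minn n c)%N,
    let first_k := widen_ord le_k in
    [/\ svd_U X = colsub first_k P,
        svd_S X = diag_mx (colsub first_k s)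
      & svd_V X = colsub first_k Q].

(* A routine computing SVD results of matrices with c columns. Matrices without
   rows are excluded: they have no SVD result with k >= 1. *)
Definition svd_routine_spec (R : realType) (xi : R) (c : nat)
    (svd : forall n : nat, 'M[R]_(n, c) -> svd_result R n c) : Prop :=
  forall (n : nat) (M : 'M[R]_(n, c)), (0 < n)%N -> is_svd_result xi M (svd n M).

(* A computed value together with the number of arithmetic operations spent. *)
Definition costed (T : Type) : Type := (T * nat)%type.

Definition cret (T : Type) (x : T) : costed T := (x, 0%N).

Definition cbind (T T' : Type) (m : costed T) (f : T -> costed T') : costed T' :=
  let: (x, n1) := m in let: (y, n2) := f x in (y, (n1 + n2)%N).

Notation "'let*' x := m 'in' f" := (cbind m (fun x => f))
  (at level 200, x name, m at level 100, f at level 200).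

(* [cost_svd n c]: cost of the SVD of an n x c matrix; [cost_mul p q s]: cost of
   multiplying a p x q matrix by a q x s matrix. *)
Definition svd_cost_bound (cost_svd : nat -> nat -> nat) : Prop :=
  exists K : nat, forall n c : nat, (0 < n)%N -> (0 < c)%N ->
    (cost_svd n c <= K * minn (n ^ 2 * c) (n * c ^ 2))%N.

Definition mul_cost_bound (cost_mul : nat -> nat -> nat -> nat) : Prop :=
  exists K : nat, forall p q s : nat, (0 < p)%N -> (0 < q)%N -> (0 < s)%N ->
    (cost_mul p q s <= K * (p * q * s))%N.

Definition costed_mul (cost_mul : nat -> nat -> nat -> nat) (R : realType)
    (p q s : nat) (A : 'M[R]_(p, q)) (B : 'M[R]_(q, s)) : costed 'M[R]_(p, s) :=
  (A *m B, cost_mul p q s).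

Definition costed_svd (cost_svd : nat -> nat -> nat) (R : realType) (c : nat)
    (svd : forall n : nat, 'M[R]_(n, c) -> svd_result R n c)
    (n : nat) (M : 'M[R]_(n, c)) : costed (svd_result R n c) :=
  (svd n M, cost_svd n c).

(* The SVD result of a block, paired with the number of its rows. *)
Definition block_svd (R : realType) (c : nat) : Type :=
  {n : nat & svd_result R n c}.

(* [current] is the SVD result of the incomplete block, if there is one;
   [stored] holds those of the blocks 0, ..., i - 1, where i is its size. *)
Record storage (R : realType) (c : nat) := Storage {
  current : option (block_svd R c);
  stored : seq (block_svd R c) }.

Definition append_row (cost_svd : nat -> nat -> nat)
    (cost_mul : nat -> nat -> nat -> nat) (R : realType) (c : nat)
    (svd : forall n : nat, 'M[R]_(n, c) -> svd_result R n c)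
    (n : nat) (X : svd_result R n c) (a : 'rV[R]_c) :
    costed (svd_result R (n + 1) c) :=
  let* SVt := costed_mul cost_mul (svd_S X) (svd_V X)^T in
  let* Y := costed_svd cost_svd svd (col_mx SVt a) in
  let* U := costed_mul cost_mul (block_mx (svd_U X) 0 0 1%:M) (svd_U Y) in
  cret (SvdResult U (svd_S Y) (svd_V Y)).

(* The triple (U_(i,t), Sigma_(i,t), V_(i,t)) obtained from the new row a. *)
Definition update (cost_svd : nat -> nat -> nat)
    (cost_mul : nat -> nat -> nat -> nat) (R : realType) (c : nat)
    (svd : forall n : nat, 'M[R]_(n, c) -> svd_result R n c)
    (st : storage R c) (a : 'rV[R]_c) : costed (block_svd R c) :=
  match current st with
  | None =>
      let* X := costed_svd cost_svd svd a in
      cret (existT (fun n => svd_result R n c) 1%N X)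
  | Some (existT n X) =>
      let* Y := append_row cost_svd cost_mul svd X a in
      cret (existT (fun n => svd_result R n c) (n + 1)%N Y)
  end.

Definition store (R : realType) (c b : nat) (st : storage R c)
    (X : block_svd R c) : storage R c :=
  if tag X == b then Storage None (rcons (stored st) X)
  else Storage (Some X) (stored st).

Definition process_row (cost_svd : nat -> nat -> nat)
    (cost_mul : nat -> nat -> nat -> nat) (R : realType) (c b : nat)
    (svd : forall n : nat, 'M[R]_(n, c) -> svd_result R n c)
    (st : storage R c) (a : 'rV[R]_c) : costed (storage R c) :=
  let* X := update cost_svd cost_mul svd st a in
  cret (store b st X).

(* The storage after the arrival of rows a 1, ..., a t (a 0 is not used). The
   first row is processed like the first row of any other block. *)
Fixpoint storage_at (cost_svd : nat -> nat -> nat)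
    (cost_mul : nat -> nat -> nat -> nat) (R : realType) (c b : nat)
    (svd : forall n : nat, 'M[R]_(n, c) -> svd_result R n c)
    (a : nat -> 'rV[R]_c) (t : nat) : storage R c :=
  if t is t'.+1 then
    (process_row cost_svd cost_mul b svd
       (storage_at cost_svd cost_mul b svd a t') (a t)).1
  else Storage None [::].

Definition block_rank (R : realType) (c : nat) (X : block_svd R c) : nat :=
  svd_rank (tagged X).

(* Main.v *)
(* Processing a row costs two products and one SVD of a matrix with at most
   k + 1 rows. A retained number of singular values is at least 1, so that
   k + 1 <= 2k, and an incomplete block has fewer than b rows: the SVD and the
   product Sigma V^T cost O(k^2 c), the product forming the new U costs
   O(k^2 b). *)
Require Import Defs.
From mathcomp Require Import all_boot all_order all_algebra.
From mathcomp Require Import reals.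
From mathcomp Require Import zify.

Set Implicit Arguments.
Unset Strict Implicit.
Unset Printing Implicit Defensive.

Import Order.TTheory GRing.Theory Num.Theory.
Local Open Scope ring_scope.

Lemma retained_number_gt0 (R : realType) (xi : R) (p : nat) (s : 'rV[R]_p)
    (r k : nat) : is_retained_number xi s r k -> (0 < k)%N.
Proof. by rewrite /is_retained_number; case: eqP => [_ -> //|_ [/andP[]]]. Qed.

Lemma svd_routine_rank_gt0 (R : realType) (xi : R) (c : nat)
    (svd : forall n : nat, 'M[R]_(n, c) -> svd_result R n c)
    (n : nat) (M : 'M[R]_(n, c)) :
  svd_routine_spec xi svd -> (0 < n)%N -> (0 < svd_rank (svd n M))%N.
Proof.
by move=> svdP /(svdP n M) [P [s [Q [_ [/retained_number_gt0 rank_gt0 _]]]]].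
Qed.

(** In both branches the rank comes from an SVD of a matrix that contains the new row, hence has
    rows. This yields [k >= 1] even at the start of a block. *)
Lemma block_rank_update_gt0 (cost_svd : nat -> nat -> nat)
    (cost_mul : nat -> nat -> nat -> nat) (R : realType) (xi : R) (c : nat)
    (svd : forall n : nat, 'M[R]_(n, c) -> svd_result R n c)
    (st : storage R c) (a : 'rV[R]_c) :
  svd_routine_spec xi svd ->
  (0 < block_rank (update cost_svd cost_mul svd st a).1)%N.
Proof.
move=> svdP; rewrite /update /block_rank.
case: (current st) => [[n X]|] /=; apply: (svd_routine_rank_gt0 _ svdP) => //.
by rewrite addn1.
Qed.

(** Invariant by induction on time: a block grows by one row at a time and [store] closes it at
    exactly [b] rows, so the count cannot skip past [b]. *)
Lemma current_storage_at (cost_svd : nat -> nat -> nat)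
    (cost_mul : nat -> nat -> nat -> nat) (R : realType) (xi : R) (b c : nat)
    (svd : forall n : nat, 'M[R]_(n, c) -> svd_result R n c)
    (a : nat -> 'rV[R]_c) (t : nat) (X : block_svd R c) :
  (0 < b)%N -> svd_routine_spec xi svd ->
  current (storage_at cost_svd cost_mul b svd a t) = Some X ->
  (tag X < b)%N /\ (0 < block_rank X)%N.
Proof.
move=> b_gt0 svdP; elim: t X => [//|t IHt] X /=.
set st := storage_at _ _ _ _ _ t in IHt *.
have := block_rank_update_gt0 cost_svd cost_mul st (a t.+1) svdP.
(* A block being extended had fewer than [b] rows; a fresh one has a single row, and [0 < b]. *)
have: (tag (update cost_svd cost_mul svd st (a t.+1)).1 <= b)%N.
  rewrite /update; case def_cur: (current st) => [[n Y]|] //=.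
  by have [] := IHt _ def_cur; rewrite addn1.
rewrite /process_row; case: (update _ _ _ _ _) => Y m /= leYb Y_gt0.
rewrite /store; case: eqP => //= /eqP neYb [<-].
by rewrite ltn_neqAle neYb.
Qed.

(* k bounds the numbers of singular values retained by the SVD results involved
   in processing row a t: the one of the current block before (if there is one)
   and the one after. *)
Theorem theorem1 (cost_svd : nat -> nat -> nat)
    (cost_mul : nat -> nat -> nat -> nat)
    (hsvd : svd_cost_bound cost_svd) (hmul : mul_cost_bound cost_mul) :
  exists C : nat,
  forall (R : realType) (xi : R) (b c : nat)
    (svd : forall n : nat, 'M[R]_(n, c) -> svd_result R n c)
    (a : nat -> 'rV[R]_c) (t k : nat),
  0 < xi < 1 -> (0 < b)%N -> (0 < c)%N -> svd_routine_spec xi svd ->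
  (0 < t)%N ->
  let st := storage_at cost_svd cost_mul b svd a t.-1 in
  (forall X, current st = Some X -> (block_rank X <= k)%N) ->
  (block_rank (update cost_svd cost_mul svd st (a t)).1 <= k)%N ->
  ((process_row cost_svd cost_mul b svd st (a t)).2
     <= C * (k ^ 2 * (b + c)))%N.
Proof.
have [Ks svd_le] := hsvd; have [Km mul_le] := hmul.
(* The 4 is the square in [(2 * k) ^ 2] for an SVD with at most [2 * k] rows; the 3 adds 1 for the
   product Sigma V^T and 2 for the new U. *)
exists (4 * Ks + 3 * Km)%N => R xi b c svd a t k _ b_gt0 c_gt0 svdP _ st.
move=> cur_le new_le.
have new_gt0 := block_rank_update_gt0 cost_svd cost_mul st (a t) svdP.
have k_gt0 : (0 < k)%N := leq_trans new_gt0 new_le.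
have svd_rows_le m : (0 < m <= 2 * k)%N ->
    (cost_svd m c <= 4 * Ks * (k ^ 2 * c))%N.
  case/andP=> m_gt0 le_m; apply: leq_trans (svd_le _ _ m_gt0 c_gt0) _.
  rewrite (mulnC 4) -mulnA leq_mul2l; apply/orP; right.
  apply: leq_trans (geq_minl _ _) _.
  by rewrite mulnA leq_mul2r -(expnMn 2 k 2) leq_exp2r // le_m orbT.
move: new_gt0 new_le; rewrite /process_row /update.
case def_cur: (current st) => [[n X]|] /=; last first.
  (* First row of a block: the only cost is the SVD of one row. *)
  move=> _ _; rewrite !addn0.
  have /svd_rows_le le1 : (0 < 1 <= 2 * k)%N by lia.
  apply: leq_trans le1 _; apply: leq_mul; first exact: leq_addr.
  by rewrite leq_mul2l leq_addl orbT.
rewrite /block_rank /= !addn0.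
have [/= lt_nb r_gt0] := current_storage_at b_gt0 svdP def_cur.
have := cur_le _ def_cur; rewrite /block_rank /= in r_gt0 *.
set r := svd_rank X in r_gt0 *; set q := svd_rank _ => le_rk q_gt0 le_qk.
have /svd_rows_le le_svd : (0 < r + 1 <= 2 * k)%N by lia.
have le_SV : (cost_mul r r c <= Km * (k ^ 2 * c))%N.
  apply: leq_trans (mul_le _ _ _ r_gt0 r_gt0 c_gt0) _.
  by rewrite leq_mul2l leq_mul ?orbT // leq_mul.
have le_U : (cost_mul (n + 1) (r + 1) q <= Km * (2 * (k ^ 2 * b)))%N.
  apply: leq_trans (mul_le _ _ _ _ _ q_gt0) _; rewrite ?addn1 //.
  (* The factors on the right bound [n + 1], [r + 1] and [q], in this order. *)
  have -> : (2 * (k ^ 2 * b) = b * (2 * k) * k)%N by lia.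
  by rewrite leq_mul2l !leq_mul ?orbT //; lia.
apply: leq_trans (leq_add le_SV (leq_add le_svd le_U)) _.
nia.
Qed.
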